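(* The principle $\Diamond(\mathfrak{b})$ implies that there is an uncountable $\gamma$-set.
   Context: $\Diamond(\mathfrak{b})$ is the statement: for every function $F:2^{<\omega_1}\to\omega^\omega$ such that $F\upharpoonright 2^\alpha$ is Borel for each $\alpha<\omega_1$, there exists $g:\omega_1\to\omega^\omega$ such that for every $f\in 2^{\omega_1}$ the set of $\delta<\omega_1$ with $\exists^\infty n\ F(f\upharpoonright\delta)(n)<g(\delta)(n)$ is stationary. An open cover $\mathcal{U}$ of a space $X$ is an $\omega$-cover if $X\notin\mathcal{U}$ and every finite subset of $X$ is contained in some member of $\mathcal{U}$; it is a $\gamma$-cover if it is infinite and each $x\in X$ lies in all but finitely many members. A $\gamma$-set is a separable metric space in which every open $\omega$-cover contains a $\gamma$-subcover. *)

(* Defs.v *)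
From HB Require Import structures.
From mathcomp Require Import all_boot all_order all_algebra.
From mathcomp Require Import all_classical all_reals all_analysis.
From mathcomp Require wochoice.

Set Implicit Arguments.
Unset Strict Implicit.
Unset Printing Implicit Defensive.

Import Order.TTheory.

Local Open Scope classical_set_scope.
Local Open Scope order_scope.

(* These properties characterise the ordinal omega_1 up to a unique order
   isomorphism; [omega1_modelP] below provides a model. *)
Definition is_omega1 (d : Order.disp_t) (W : orderType d) : Prop :=
  [/\ wochoice.well_order (<=%O : rel W),
      ~ countable [set: W]
    & forall a : W, countable [set x | x < a]].

Section omega1_model.

(* The elements of a well-ordered uncountable set that have only countably many
   predecessors. *)
Let T := set nat.
Let r : rel T := sval (wochoice.well_ordering_principle T).
Let rW : wochoice.well_order r :=
  svalP (wochoice.well_ordering_principle T).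

Definition omega1_model : Type :=
  {x : T | `[< countable [set y | r y x] >]}.

HB.instance Definition _ := Choice.on omega1_model.

Let leM (x y : omega1_model) := r (sval x) (sval y).
Let ltM (x y : omega1_model) := (y != x) && leM x y.

Let rtot : total r.
Proof.
move=> x y; have [|z [[/orP[] /eqP -> h] _]] :=
  rW (A := [pred z | (z == x) || (z == y)]); first by exists x; rewrite inE eqxx.
- by rewrite h // inE eqxx orbT.
- by rewrite orbC h // inE eqxx.
Qed.

Let ranti : antisymmetric r.
Proof.
move=> x y /andP[xy yx].
have rr z : r z z by have := rtot z z; rewrite orbb.
have [|z [_ u]] :=
  rW (A := [pred z | (z == x) || (z == y)]); first by exists x; rewrite inE eqxx.
rewrite -(u x) ?(u y) //; split; rewrite ?inE ?eqxx ?orbT // => t;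
  by rewrite inE => /orP[] /eqP ->.
Qed.

Let rtrans : transitive r.
Proof.
move=> y x z xy yz.
have [|t [[At h] _]] := rW (A := [pred t | [|| t == x, t == y | t == z]]).
  by exists x; rewrite inE eqxx.
have hx : r t x by apply: h; rewrite inE eqxx.
have hy : r t y by apply: h; rewrite inE eqxx ?orbT.
have hz : r t z by apply: h; rewrite inE eqxx ?orbT.
move: At; rewrite inE => /or3P[] /eqP e; subst t => //.
- by rewrite (ranti (x := x) (y := y)) // xy hx.
- by rewrite -(ranti (x := y) (y := z)) // yz hy.
Qed.

Let ltM_def x y : ltM x y = (y != x) && leM x y. Proof. by []. Qed.
Let leM_anti : antisymmetric leM.
Proof. by move=> x y h; apply/val_inj/ranti. Qed.
Let leM_trans : transitive leM. Proof. by move=> y x z; apply: rtrans. Qed.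
Let leM_total : total leM. Proof. by move=> x y; apply: rtot. Qed.

Fact omega1_display : Order.disp_t. Proof. exact: Order.default_display. Qed.

HB.instance Definition _ := Order.isOrder.Build omega1_display omega1_model
  ltM_def (fun _ _ => erefl) (fun _ _ => erefl) leM_anti leM_trans leM_total.

Lemma omega1_modelP : is_omega1 omega1_model.
Proof.
have wo : wochoice.well_order (<=%O : rel omega1_model).
  apply: wochoice.antisymmetric_well_order => [|A [x Ax]]; first exact: leM_anti.
  have [|z [[Az h] _]] := rW (A := [pred t | `[< exists2 y, y \in A & sval y = t >]]).
    by exists (sval x); rewrite inE; exists x.
  move: Az; rewrite inE => -[y Ay yz].
  exists y; split => // t At; rewrite -[_ <= _]/(r _ _) yz; apply: h.
  by rewrite inE; exists t.
have pred_cnt (a : omega1_model) : countable [set x | x < a].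
  have /asboolP/countable_injP[f finj] := svalP a.
  apply/countable_injP; exists (f \o sval) => x y.
  rewrite !inE /= => /ltW xa /ltW ya /finj xy.
  by apply/val_inj/xy; rewrite inE.
split=> // cW.
have cS : countable (range (sval : omega1_model -> T)).
  exact: sub_countable (card_image_le _ _) cW.
have cT : [set: T] `<=` range (sval : omega1_model -> T).
  apply: contrapT => /existsNP[x0 /not_implyP[_ x0S]].
  have [|z [[zS h] _]] :=
    rW (A := [pred t | ~~ `[< range (sval : omega1_model -> T) t >]]).
    by exists x0; rewrite inE; apply/asboolPn.
  move: zS; rewrite inE => /asboolPn; apply.
  have cz : countable [set y | r y z].
    have : countable (\bigcup_(b in [set: bool])
        if b then range (sval : omega1_model -> T) else [set z]).
      by apply: bigcup_countable => // -[].
    apply: sub_countable; apply: subset_card_le => y /= yz.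
    have [yS|yS] := pselect (range (sval : omega1_model -> T) y).
      by exists true.
    exists false => //=; apply: ranti; rewrite yz; apply: h.
    by rewrite inE; apply/asboolPn.
  by exists (exist _ z (asboolT cz)).
have /countable_injP[f finj] := sub_countable (subset_card_le cT) cS.
pose D : T := [set n | exists2 A : T, f A = n & ~ A n].
have [DD|DD] := pselect (D (f D)); last by apply: (DD); exists D.
case: (DD) => A fA; apply; suff -> : A = D by [].
by apply: finj => //; rewrite inE.
Qed.

End omega1_model.

Definition club (d : Order.disp_t) (W : orderType d) (C : set W) : Prop :=
  (forall a, exists2 c, C c & a < c) /\
  (forall a, (exists b, b < a) ->
    (forall b, b < a -> exists2 c, C c & b < c < a) -> C a).

Definition stationary (d : Order.disp_t) (W : orderType d) (S : set W) : Prop :=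
  forall C : set W, club C -> S `&` C !=set0.

(* Product of copies of the discrete space bool indexed by the predecessors of
   a, i.e. 2^a. *)
Definition binseq (d : Order.disp_t) (W : orderType d) (a : W) : topologicalType :=
  prod_topology (fun _ : {x : W | x < a} => bool).

Definition restr (d : Order.disp_t) (W : orderType d) (f : W -> bool) (a : W) :
  binseq a := fun x => f (sval x).
Arguments restr {d W} f a.

Definition baire : topologicalType := prod_topology (fun _ : nat => nat).

Definition borel_fun (X Y : topologicalType) (f : X -> Y) : Prop :=
  forall U : set Y, open U -> <<s (@open X) >> (f @^-1` U).

Definition diamond_b (d : Order.disp_t) (W : orderType d) : Prop :=
  forall F : forall a : W, binseq a -> baire,
    (forall a, borel_fun (F a)) ->
    exists g : W -> baire, forall f : W -> bool,
      stationary [set a | forall m : nat, exists2 n : nat,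
        (m <= n)%N & (F a (restr f a) n < g a n)%N].

Section covers.
Variable X : topologicalType.
Implicit Types U V : set (set X).

Definition open_cover U : Prop :=
  (forall A, U A -> open A) /\ \bigcup_(A in U) A = [set: X].

Definition omega_cover U : Prop :=
  [/\ open_cover U, ~ U [set: X]
    & forall K : set X, finite_set K -> exists2 A, U A & K `<=` A].

Definition gamma_cover U : Prop :=
  [/\ open_cover U, infinite_set U
    & forall x, finite_set [set A | U A /\ ~ A x]].

Definition separable_space : Prop := exists2 D : set X, countable D & dense D.

End covers.

Definition gamma_set (R : realType) (X : metricType R) : Prop :=
  separable_space X /\
  forall U : set (set X), omega_cover U ->
    exists2 V, V `<=` U & gamma_cover V.

(* Main.v *)
Require Import Defs.
From HB Require Import structures.
From mathcomp Require Import all_boot all_order all_algebra.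
From mathcomp Require Import all_classical all_reals all_analysis.

(* Reading a function off the bits of f : omega_1 -> 2 is a Borel operation, so
   diamond(b) provides g_a (a < omega_1) such that no function eventually
   dominates every g_a. By recursion build an almost decreasing sequence of
   infinite sets x_a of naturals with consecutive points separated according to
   g_a; then for every partition of the naturals into intervals some x_a misses
   infinitely many of the intervals.

   The space is X = {x_a} u Fin in the Cantor space (Galvin-Miller,
   Orenshtein-Tsaban). Given an omega-cover U and a < omega_1, covering the
   finitely many subsets of an initial segment of the naturals by one member of
   U gives A_k in U and intervals I_k such that every point of X missing I_k is
   in A_k, while each x_b with b < a is in almost all A_k.
   Some x_c misses infinitely many I_k, hence so does each x_b with c <= b.
   Iterating a |-> c and taking the supremum of the resulting sequence a_n, one
   diagonalises through the covers attached to the a_n: choose the n-th index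
   so that x_(sup a_n) misses the chosen interval. *)

Set Implicit Arguments.
Unset Strict Implicit.
Unset Printing Implicit Defensive.

Import Order.TTheory GRing.Theory Num.Theory.

Local Open Scope order_scope.
Local Open Scope classical_set_scope.

(** * Bounds, suprema and recursion on omega_1 *)

Section omega1.
Variables (d : Order.disp_t) (W : orderType d).
Hypothesis HW : is_omega1 W.

Lemma omega1_min (A : set W) : A !=set0 ->
  exists2 a, A a & forall b, A b -> a <= b.
Proof.
move=> [x Ax]; case: HW => wo _ _.
have [|a [[Aa amin] _]] := wo [pred y | `[< A y >]].
  by exists x; rewrite inE.
exists a; first by move: Aa; rewrite inE.
by move=> b Ab; apply: amin; rewrite inE.
Qed.

Lemma omega1_lt_wf : well_founded (fun x y : W => x < y).
Proof.
move=> x; apply: contrapT => nAx.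
have [a nAa amin] := @omega1_min [set y | ~ Acc (fun x y : W => x < y) y]
  (ex_intro _ x nAx).
apply: nAa; constructor => y ya; apply: contrapT => /amin.
by rewrite leNgt ya.
Qed.

(** Without such a bound the uncountable [W] would be the union of the countable initial segments
    ending at the [s n]. *)
Lemma omega1_ub (s : nat -> W) : exists a, forall n, s n < a.
Proof.
apply: contrapT => nub; case: HW => _ + ltc; apply.
have -> : [set: W] = \bigcup_(p in [set: nat * bool])
    (if p.2 then [set x | x < s p.1] else [set s p.1]).
  rewrite eqEsubset; split=> // a _; apply: contrapT => na.
  apply: nub; exists a => n; rewrite ltNge; apply/negP.
  rewrite le_eqVlt => /predU1P[an|an]; apply: na; first by exists (n, false).
  by exists (n, true).
apply: bigcup_countable => // -[n []] _ /=; first exact: ltc.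
exact: countable1.
Qed.

Lemma omega1_sup (s : nat -> W) :
  exists2 a, forall n, s n <= a & forall b, b < a -> exists n, b < s n.
Proof.
have [u us] := omega1_ub s.
have [|a sa amin] := @omega1_min [set a | forall n, s n <= a].
  by exists u => n; exact: ltW.
exists a => // b ba; apply: contrapT => nb.
suff /amin : [set a | forall n, s n <= a] b by rewrite leNgt ba.
by move=> n; rewrite leNgt; apply/negP => bn; apply: nb; exists n.
Qed.

(** For constructions in which a next value is known to exist only if the earlier ones are good. The
    function is defined first, with [t0] as default, and well-founded induction then shows that a
    good value was available at every [a]. *)
Lemma omega1_recursion (T : choiceType) (t0 : T)
    (P : W -> (W -> T) -> T -> Prop) :
  (forall a f f' t, (forall b, b < a -> f b = f' b) -> P a f t -> P a f' t) ->
  (forall a f, (forall b, b < a -> P b f (f b)) -> exists t, P a f t) ->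
  exists f, forall a, P a f (f a).
Proof.
move=> Plocal Pex.
pose ext (a : W) (f : forall b, b < a -> T) : W -> T :=
  fun b => if pselect (b < a) is left ba then f b ba else t0.
pose G (a : W) (f : forall b, b < a -> T) : T := xget t0 (P a (ext a f)).
pose f := Fix omega1_lt_wf (fun=> T) G.
have fE a : f a = G a (fun b _ => f b).
  rewrite /f Fix_eq// => {}a g g' gg'; congr (G a).
  apply: functional_extensionality_dep => b.
  by apply/funext => ba; exact: gg'.
have extE a b : b < a -> ext a (fun b _ => f b) b = f b.
  by move=> ba; rewrite /ext; case: pselect.
exists f => a; elim/(well_founded_induction omega1_lt_wf): a => a IH.
have [t Pt] := Pex a f IH.
rewrite fE /G; apply: (Plocal a (ext a (fun b _ => f b))); first exact: extE.
apply: (@xgetPex _ t0 (P a (ext a (fun b _ => f b)))).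
by exists t; apply: Plocal Pt => b ba; rewrite extE.
Qed.

End omega1.

(** * Borel sets, and Borel maps into the Baire space *)

Section borel.
Variable X : topologicalType.
Implicit Types A B : set X.

Lemma borelC A : <<s (@open X) >> A -> <<s (@open X) >> (~` A).
Proof. by move=> mA; rewrite -setTD; exact: sigma_algebraCD. Qed.

Lemma borelI A B : <<s (@open X) >> A -> <<s (@open X) >> B ->
  <<s (@open X) >> (A `&` B).
Proof.
move=> mA mB; rewrite -[A `&` B]setCK setCI; apply: borelC.
rewrite -bigcup2E; apply: sigma_algebra_bigcup => -[|[|n]] /=.
- exact: borelC.
- exact: borelC.
- exact: sigma_algebra0.
Qed.

Lemma borel_bigcap (A : nat -> set X) : (forall n, <<s (@open X) >> (A n)) ->
  <<s (@open X) >> (\bigcap_n A n).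
Proof.
move=> mA; rewrite -[\bigcap_n A n]setCK setC_bigcap; apply: borelC.
by apply: sigma_algebra_bigcup => n; exact: borelC.
Qed.

Lemma borel_cst (P : Prop) : <<s (@open X) >> [set _ | P].
Proof.
apply: sub_sigma_algebra.
have [p|np] := pselect P.
  have -> : [set _ : X | P] = setT by rewrite eqEsubset; split.
  exact: openT.
have -> : [set _ : X | P] = set0 by rewrite eqEsubset; split.
exact: open0.
Qed.

(** Otherwise points outside [U] that agree with [y] on ever longer initial segments would converge
    to [y]. *)
Lemma baire_open_cylinder (U : set baire) (y : baire) : open U -> U y ->
  exists N, forall z : baire, (forall i, (i < N)%N -> z i = y i) -> U z.
Proof.
move=> oU Uy; apply: contrapT => nN.
have /choice[z zP] : forall N, exists z : baire,
    (forall i, (i < N)%N -> z i = y i) /\ ~ U z.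
  move=> N; apply: contrapT => nz; apply: nN; exists N => z zy.
  by apply: contrapT => nUz; apply: nz; exists z.
have : z @ \oo --> y.
  apply/cvg_sup => i A; rewrite nbhsE => -[B [[C oC <-] Cy] BA].
  exists i.+1 => // n /= iltn; apply: BA => /=.
  by have [-> //] := zP n.
move=> /(_ U (open_nbhs_nbhs (conj oU Uy))) [N _ /(_ N (leqnn N))].
by case: (zP N).
Qed.

Lemma borel_fun_baire (f : X -> baire) :
  (forall n k, <<s (@open X) >> [set x | f x n = k]) -> borel_fun f.
Proof.
move=> mf U oU.
pose C (s : seq nat) : set X := [set x | [set y : baire | forall i,
    (i < size s)%N -> y i = nth 0%N s i] `<=` U] `&`
  \bigcap_i [set x | (i < size s)%N -> f x i = nth 0%N s i].
have mC s : <<s (@open X) >> (C s).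
  apply: borelI; first exact: borel_cst.
  apply: borel_bigcap => i; have [iN|iN] := boolP (i < size s)%N.
    rewrite (_ : [set x | _] = [set x | f x i = nth 0%N s i]); first exact: mf.
    by rewrite eqEsubset; split=> x //= /(_ isT).
  rewrite (_ : [set x | _] = [set _ | True]); first exact: borel_cst.
  by rewrite eqEsubset; split.
(* [U] is the union of the cylinders it contains, and these are indexed by the countably many finite
   sequences. *)
suff -> : f @^-1` U = \bigcup_n C (odflt [::] (unpickle n)).
  by apply: sigma_algebra_bigcup => n; exact: mC.
rewrite eqEsubset; split=> x; last first.
  by move=> [n _ [/= sU fs]]; apply: sU => i lt_i; exact: fs.
move=> /(baire_open_cylinder oU)[N fN].
exists (pickle (mkseq (f x) N)) => //; rewrite pickleK; split=> /=.
  by rewrite size_mkseq => y yx; apply: fN => i iN; rewrite yx// nth_mkseq.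
by move=> i _ /=; rewrite size_mkseq => iN; rewrite nth_mkseq.
Qed.

End borel.

(** * Coding functions by sequences of bits *)

Section decode.
Variables (d : Order.disp_t) (W : orderType d).
Variable e : nat -> nat -> W.

(** A sequence in [binseq a] has only the positions below [a]; any other position counts as an unset
    bit. *)
Definition code_bit (a : W) (s : binseq a) (n k : nat) : Prop :=
  exists p : e n k < a, s (exist _ (e n k) p).

(* The value at [n] is [0] when no bit [e n k] is set. *)
Definition decode (a : W) (s : binseq a) : baire := fun n =>
  xget 0%N [set k | code_bit s n k /\ forall j, (j < k)%N -> ~ code_bit s n j].

Lemma borel_code_bit (a : W) n k :
  <<s (@open (binseq a)) >> [set s | code_bit s n k].
Proof.
have [p|np] := pselect (e n k < a).
  apply: sub_sigma_algebra.
  have -> : [set s | code_bit s n k] =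
      (fun s : binseq a => s (exist _ (e n k) p)) @^-1` [set true].
    rewrite eqEsubset; split=> s /=; last by exists p.
    by case=> q; rewrite (Prop_irrelevance q p).
  apply: open_comp; last exact: discrete_open.
  by move=> s _; exact: proj_continuous.
rewrite (_ : [set s | _] = [set _ | False]); first exact: borel_cst.
by rewrite eqEsubset; split=> s //= -[].
Qed.

Lemma borel_fun_decode (a : W) : borel_fun (@decode a).
Proof.
apply: borel_fun_baire => n k.
pose G j : set (binseq a) := [set s | code_bit s n j] `&`
  \bigcap_i [set s | (i < j)%N -> ~ code_bit s n i].
have mG j : <<s (@open (binseq a)) >> (G j).
  apply: borelI; first exact: borel_code_bit.
  apply: borel_bigcap => i; have [ij|ij] := boolP (i < j)%N.
    rewrite (_ : [set s | _] = ~` [set s | code_bit s n i]).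
      by apply: borelC; exact: borel_code_bit.
    by rewrite eqEsubset; split=> s //= /(_ isT).
  rewrite (_ : [set s | _] = [set _ | True]); first exact: borel_cst.
  by rewrite eqEsubset; split.
have Guniq s i j : G i s -> G j s -> i = j.
  move=> [/= ci ni] [/= cj nj]; case: (ltngtP i j) => // ij.
    by case: (nj i I ij).
  by case: (ni j I ij).
have GE s : [set k | code_bit s n k /\ forall j, (j < k)%N -> ~ code_bit s n j]
    = [set k | G k s].
  rewrite eqEsubset; split=> j /= [cj nj]; split=> // i; last exact: nj.
  by move=> _; exact: nj.
(* Either [k] is the least set bit of row [n], or [k] is the default [0] and the row is empty. The
   union is expressed by complements and intersections. *)
have -> : [set s | decode s n = k] =
    ~` (~` G k `&` ~` ([set _ | k = 0%N] `&` \bigcap_j ~` G j)).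
  rewrite -setCU setCK eqEsubset; split=> s /=; rewrite /decode GE.
    case: xgetP => [j -> /= Gj <-|noG <-]; first by left.
    by right; split=> // j _ /=; exact: noG.
  case=> [Gk|[-> noG]].
    by apply: xget_unique => // j Gj; exact: Guniq Gj Gk.
  by case: xgetP => // j _ /(noG j I).
apply: borelC; apply: borelI; apply: borelC; first exact: mG.
apply: borelI; first exact: borel_cst.
by apply: borel_bigcap => j; exact: borelC.
Qed.

(** The graph of [h] is transported by the injection [e], so row [n] has a single set bit, at
    [h n]. *)
Lemma decode_graph (a : W) (h : nat -> nat) :
  (forall n k m l, e n k = e m l -> n = m /\ k = l) ->
  (forall n k, e n k < a) ->
  decode (restr (fun x => `[< exists n, x = e n (h n) >]) a) = h.
Proof.
move=> einj ea; apply/funext => n.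
have bitE k : code_bit (restr (fun x => `[< exists n, x = e n (h n) >]) a) n k
    <-> k = h n.
  split=> [[p /asboolP[m /= /einj[-> ->]]] //|->].
  by exists (ea n (h n)); apply/asboolP; exists n.
apply: xget_unique => [|k [/bitE]] //; split; first exact/bitE.
by move=> j jh /bitE jE; rewrite jE ltnn in jh.
Qed.

End decode.

(** All code positions lie below one [a0], so for [a] above [a0] the restriction to [a] of the code
    of [h] decodes to [h]. The stationary set obtained for this code meets the club of such [a]. *)
Lemma diamond_b_unbounded (d : Order.disp_t) (W : orderType d) :
  is_omega1 W -> diamond_b W ->
  exists g : W -> nat -> nat, forall h : nat -> nat, exists a,
    forall m, exists2 n, (m <= n)%N & (h n < g a n)%N.
Proof.
move=> HW dW.
have [x0 _] : [set: W] !=set0.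
  by apply: infinite_setN0; case: HW => _ nc _ /finite_set_countable.
have /choice[next nextP] : forall a : W, exists b, a < b.
  by move=> a; have [b /(_ 0%N)] := omega1_ub HW (fun=> a); exists b.
pose i n := iter n next x0.
have imono : {homo i : n m / (n < m)%N >-> n < m}.
  by apply: homo_ltn => [|n]; [exact: lt_trans|exact: nextP].
have iinj : injective i.
  by move=> n m e; case: (ltngtP n m) => // /imono; rewrite e ltxx.
pose e (n k : nat) := i (pickle (n, k)).
have einj n k m l : e n k = e m l -> n = m /\ k = l.
  by move=> /iinj/(pcan_inj pickleK)[].
have [a0 a0P] := omega1_ub HW i.
have [g gP] := dW _ (borel_fun_decode e).
exists g => h.
have [|a [/= ga a0a]] := gP (fun x => `[< exists n, x = e n (h n) >])
    [set a | a0 < a].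
  split=> [a|a [b ba] aC].
    have [c cP] := omega1_ub HW (fun n => if n is 0%N then a else a0).
    by exists c; [exact: (cP 1%N)|exact: (cP 0%N)].
  by have [c /= a0c /andP[_ ca]] := aC b ba; exact: lt_trans ca.
exists a => m; have [n mn] := ga m.
rewrite decode_graph//; first by exists n.
by move=> n' k; exact: lt_trans (a0P _) a0a.
Qed.

(** * Almost inclusion, sparse sets and interval partitions *)

Definition infinitely (P : nat -> Prop) : Prop :=
  forall N, exists2 n, (N <= n)%N & P n.

Definition almost_sub (x y : nat -> bool) : Prop :=
  exists N, forall n, (N <= n)%N -> x n -> y n.

Definition sparse (x : nat -> bool) (g : nat -> nat) : Prop :=
  forall n a b, x a -> x b -> (n <= a < b)%N -> (g n <= b)%N.

Definition misses (x : nat -> bool) (m M : nat) : Prop :=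
  forall i, (m <= i < M)%N -> ~~ x i.

Lemma almost_sub_refl x : almost_sub x x.
Proof. by exists 0%N. Qed.

Lemma almost_sub_trans y x z :
  almost_sub x y -> almost_sub y z -> almost_sub x z.
Proof.
move=> [N xy] [M yz]; exists (maxn N M) => n; rewrite geq_max => /andP[Nn Mn].
by move=> /(xy _ Nn)/(yz _ Mn).
Qed.

Lemma eventually_finite (T : eqType) (K : set T) (P : T -> nat -> Prop) :
  finite_set K ->
  (forall t, K t -> exists N, forall n, (N <= n)%N -> P t n) ->
  exists N, forall n, (N <= n)%N -> forall t, K t -> P t n.
Proof.
move=> /finite_seqP[s ->] {K}; elim: s => [|t s IH] Ps; first by exists 0%N.
have [|N sN] := IH; first by move=> u us; apply: Ps; rewrite /= inE us orbT.
have [|M tM] := Ps t; first by rewrite /= inE eqxx.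
exists (maxn N M) => n; rewrite geq_max => /andP[Nn Mn] u /=.
by rewrite inE => /predU1P[->|us]; [exact: tM|exact: sN].
Qed.

Lemma leq_strict_mono (m : nat -> nat) k :
  (forall n, (m n < m n.+1)%N) -> (k <= m k)%N.
Proof. by move=> mS; elim: k => // k IH; exact: leq_ltn_trans IH (mS k). Qed.

(** Recursively, [a k.+1] is chosen in [y 0, ..., y k], at least [g n] for each [n <= a k], and
    beyond some point of [y k] above [a k]. That skipped point keeps [x] from being [y k]. *)
Lemma pseudointersection (y : nat -> nat -> bool) (g : nat -> nat) :
  (forall k, infinitely (fun n => forall i, (i <= k)%N -> y i n)) ->
  exists x : nat -> bool, [/\ infinitely x, forall i, almost_sub x (y i),
    forall i, x <> y i & sparse x g].
Proof.
move=> yinf.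
have /choice[st stP] : forall kp : nat * nat, exists q,
    [/\ exists2 c, (kp.2 < c < q)%N & y kp.1 c,
        forall i, (i <= kp.1)%N -> y i q
      & forall n, (n <= kp.2)%N -> (g n <= q)%N].
  move=> [k p] /=.
  have [c pc yc] := yinf k p.+1.
  have [q cq yq] := yinf k (c + \max_(n < p.+1) g n).+1.
  exists q; split=> //.
    exists c; last exact: yc.
    by rewrite pc (leq_ltn_trans _ cq)// leq_addr.
  move=> n np; apply: leq_trans (ltnW cq).
  apply: leq_trans (leq_addl _ _).
  exact: (leq_bigmax (Ordinal (np : (n < p.+1)%N))).
pose a := fix a k := if k is k.+1 then st (k, a k) else 0%N.
have aS k : (a k < a k.+1)%N.
  by have [[c /andP[/= h1 h2] _] _ _] := stP (k, a k); exact: ltn_trans h1 h2.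
have amono : {mono a : k l / (k <= l)%N}.
  by apply: leq_mono; apply: homo_ltn => //; exact: ltn_trans.
have altn := leqW_mono amono.
exists (fun n => `[< exists k, n = a k.+1 >]); split.
- move=> N; exists (a N.+1); first exact: leq_trans (leq_strict_mono _ aS).
  by apply/asboolP; exists N.
- move=> i; exists (a i.+1) => n an /asboolP[k nE].
  move: an; rewrite {n}nE amono ltnS => ik.
  by have [_ /= yq _] := stP (k, a k); exact: yq.
- move=> i yi; have [[c /andP[/= ac cq]] + _ _] := stP (i, a i).
  rewrite -yi => /asboolP[k ck]; move: ac cq; rewrite ck altn ltnS => ik.
  by rewrite -[st _]/(a i.+1) altn ltnS ltnNge ik.
- move=> n _ _ /asboolP[k ->] /asboolP[l ->]; rewrite altn ltnS => /andP[nk kl].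
  have [_ _ /= gq] := stP (l, a l); apply: gq; apply: leq_trans nk _.
  by rewrite amono.
Qed.

(* An interval [n, g n[ contains at most one point of a [g]-sparse set, hence it
   cannot contain two consecutive blocks of a partition both met by the set. *)
Lemma sparse_misses (x : nat -> bool) (g m : nat -> nat) :
  sparse x g -> (forall k, (m k < m k.+1)%N) ->
  infinitely (fun n => m n.+2 < g n)%N ->
  infinitely (fun k => misses x (m k) (m k.+1)).
Proof.
move=> xg mS mg N; have [n Nn gn] := mg N.
have [Mn|] := pselect (misses x (m n) (m n.+1)); first by exists n.
move=> /existsNP[i /not_implyP[/andP[ni im] /negP]]; rewrite negbK => xi.
exists n.+1; first exact: leqW.
move=> j /andP[mj jm]; apply/negP => xj.
have := xg n i j xi xj; rewrite (leq_trans (leq_strict_mono n mS) ni).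
rewrite (leq_trans im mj) => /(_ isT).
by rewrite leqNgt (ltn_trans jm gn).
Qed.

(** * An almost decreasing tower of sparse sets *)

Section tower.
Variables (d : Order.disp_t) (W : orderType d).
Hypothesis HW : is_omega1 W.

(** At stage [a] the earlier sets are countably many and form a chain under almost inclusion, so
    they have a sparse pseudointersection. Making it differ from all earlier sets yields
    injectivity. *)
Lemma sparse_tower (g : W -> nat -> nat) :
  exists x : W -> nat -> bool, [/\ forall b a, b < a -> almost_sub (x a) (x b),
    injective x & forall a, sparse (x a) (g a)].
Proof.
pose P a (f : W -> nat -> bool) (t : nat -> bool) := [/\ infinitely t,
  forall b, b < a -> almost_sub t (f b), forall b, b < a -> t <> f b
  & sparse t (g a)].
have [||x xP] := @omega1_recursion _ _ HW (nat -> bool) xpredT P.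
- move=> a f f' t ff' [ti tf tn ts]; split=> // b ba; rewrite -ff'//.
    exact: tf.
  exact: tn.
- move=> a f IH.
  have /countable_injP[phi phiinj] : countable [set b | b < a].
    by case: HW.
  (* [y] lists the earlier sets along [phi]; the remaining indices get the set of all naturals,
     which lies above everything. *)
  pose y i : nat -> bool :=
    if pselect (exists2 b, b < a & phi b = i) is left e
    then f (projT1 (cid2 e)) else xpredT.
  pose C (z : nat -> bool) := z = xpredT \/ exists2 b, b < a & z = f b.
  have yC i : C (y i).
    rewrite /y; case: pselect => [e|_]; last by left.
    by right; case: cid2 => b /= ba _; exists b.
  have yphi b : b < a -> y (phi b) = f b.
    move=> ba; rewrite /y; case: pselect => [e|[]]; last by exists b.
    by case: cid2 => c /= ca /phiinj ->//; rewrite inE.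
  have Cinf z : C z -> infinitely z.
    by case=> [-> N|[b ba ->]]; [exists N|case: (IH b ba)].
  have Ctotal z z' : C z -> C z' -> almost_sub z z' \/ almost_sub z' z.
    move=> [-> _|[b ba ->]]; first by right; exists 0%N.
    move=> [->|[c ca ->]]; first by left; exists 0%N.
    case: (ltgtP b c) => [bc|cb|->].
    - by right; case: (IH c ca) => _ + _ _; exact.
    - by left; case: (IH b ba) => _ + _ _; exact.
    - by left; exact: almost_sub_refl.
  (* Finitely many members of the chain have an almost smallest one; all but finitely many of its
     points lie in each of them. *)
  have Cdir k : exists2 z, C z & forall i, (i <= k)%N -> almost_sub z (y i).
    elim: k => [|k [z Cz zy]].
      exists (y 0%N) => // i; rewrite leqn0 => /eqP ->.
      exact: almost_sub_refl.
    have [zyk|ykz] := Ctotal _ _ Cz (yC k.+1).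
      exists z => // i; rewrite leq_eqVlt => /predU1P[-> //|]; exact: zy.
    exists (y k.+1) => // i; rewrite leq_eqVlt => /predU1P[->|ik].
      exact: almost_sub_refl.
    by apply: almost_sub_trans ykz _; exact: zy.
  have [k N|x [xi xy xn xs]] := @pseudointersection y (g a).
    have [z Cz zy] := Cdir k.
    have [M zM] := eventually_finite (finite_II k.+1) zy.
    have [n] := Cinf z Cz (maxn N M).
    rewrite geq_max => /andP[Nn Mn] zn; exists n => // i ik.
    exact: (zM n Mn i ik).
  by exists x; split=> // b /yphi <-.
exists x; split.
- by move=> b a; case: (xP a) => _ + _ _; exact.
- move=> a b e; case: (ltgtP a b) => // ab.
    by case: (xP b) => _ _ /(_ _ ab); rewrite e.
  by case: (xP a) => _ _ /(_ _ ab); rewrite e.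
- by move=> a; case: (xP a).
Qed.

End tower.

(** * The first-difference metric on the Cantor space *)

Section first_difference_metric.
Variable R : realType.
Implicit Types x y z : nat -> bool.

Definition first_diff x y (n : nat) : Prop :=
  x n != y n /\ forall i, (i < n)%N -> x i = y i.

Definition diff_dist x y : R :=
  if pselect (exists n, first_diff x y n) is left e
  then ((projT1 (cid e)).+1%:R^-1)%R else 0%R.

Variant diff_dist_spec x y : R -> Prop :=
| DiffDistEq of x = y : diff_dist_spec x y 0%R
| DiffDistNeq n of first_diff x y n : diff_dist_spec x y (n.+1%:R^-1)%R.

Lemma first_diff_le x y n : x n != y n ->
  exists2 k, first_diff x y k & (k <= n)%N.
Proof.
move=> xyn; have ex : exists n, x n != y n by exists n.
exists (ex_minn ex); case: ex_minnP => k xyk kmin; last exact: kmin.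
by split=> // i ik; apply/eqP; apply: contraLR ik => /kmin; rewrite -leqNgt.
Qed.

Lemma diff_distP x y : diff_dist_spec x y (diff_dist x y).
Proof.
rewrite /diff_dist; case: pselect => [e|ne].
  by case: cid => n /= xyn; exact: DiffDistNeq.
apply: DiffDistEq; apply/funext => n; apply/eqP; apply: contrapT => /negP.
by move=> /first_diff_le[k xyk _]; apply: ne; exists k.
Qed.

Lemma diff_dist_ge0 x y : (0 <= diff_dist x y)%R.
Proof. by case: diff_distP => // n _; rewrite invr_ge0. Qed.

Lemma diff_dist_ge x y n : x n != y n -> (n.+1%:R^-1 <= diff_dist x y)%R.
Proof.
case: diff_distP => [->|k [_ xyk] xyn]; first by rewrite eqxx.
rewrite lef_pV2 ?posrE ?ltr0Sn// ler_nat ltnS leqNgt.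
by apply: contra xyn => /xyk ->.
Qed.

Lemma diff_distxx x : diff_dist x x = 0%R.
Proof. by case: diff_distP => // n []; rewrite eqxx. Qed.

Lemma diff_dist0_eq x y : diff_dist x y = 0%R -> x = y.
Proof.
by case: diff_distP => // n _ /eqP; rewrite invr_eq0 pnatr_eq0.
Qed.

(** With [diff_dist_ge], this presents the distance as a supremum over all places of difference, so
    symmetry and the triangle inequality can be checked place by place. *)
Lemma diff_dist_le x y u : (forall n, x n != y n ->
  (n.+1%:R^-1 <= u)%R) -> (0 <= u)%R -> (diff_dist x y <= u)%R.
Proof. by move=> xyu u0; case: diff_distP => // n [/xyu]. Qed.

Lemma diff_dist_sym x y : diff_dist x y = diff_dist y x.
Proof.
by apply/le_anti/andP; split; apply: diff_dist_le;
  rewrite ?diff_dist_ge0// => n xyn; apply: diff_dist_ge; rewrite eq_sym.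
Qed.

Lemma diff_dist_triangle y x z :
  (diff_dist x z <= diff_dist x y + diff_dist y z)%R.
Proof.
apply: diff_dist_le => [n xzn|]; last by rewrite addr_ge0 ?diff_dist_ge0.
have [xy|xy] := eqVneq (x n) (y n).
  rewrite (le_trans (diff_dist_ge (_ : y n != z n))) -?xy//.
  by rewrite lerDr diff_dist_ge0.
by rewrite (le_trans (diff_dist_ge xy))// lerDl diff_dist_ge0.
Qed.

End first_difference_metric.

(** The argument [R] fixes the field in which the metric on this type takes its values. *)
Definition cantor_subspace (R : realType) (P : set (nat -> bool)) : Type :=
  {x : nat -> bool | `[< P x >]}.

HB.instance Definition _ R P := Choice.on (cantor_subspace R P).

HB.instance Definition _ (R : realType) P :=
  @isMetric.Build R (cantor_subspace R P)
  (fun x y => diff_dist R (sval x) (sval y))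
  (fun x => diff_distxx R (sval x))
  (fun x y e => val_inj (diff_dist0_eq e))
  (fun x y => diff_dist_sym R (sval x) (sval y))
  (fun y x z => diff_dist_triangle R (sval y) (sval x) (sval z)).

Lemma cantor_subspace_open (R : realType) P (A : set (cantor_subspace R P)) x :
  open A -> A x ->
  exists N, forall y, (forall i, (i < N)%N -> sval y i = sval x i) -> A y.
Proof.
move=> oA Ax.
have /nbhs_ballP[e /= e0 xeA] := open_nbhs_nbhs (conj oA Ax).
have [N Ne] := ltr_add_invr e0; rewrite add0r in Ne.
exists N.+1 => y xy; apply: xeA; rewrite ballEmdist /=.
apply: le_lt_trans Ne; apply: diff_dist_le; last by rewrite invr_ge0.
move=> n xyn; rewrite lef_pV2 ?posrE ?ltr0Sn// ler_nat leqNgt.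
by apply: contra xyn => nN; rewrite xy// ltnW.
Qed.

Lemma finite_bounded_by_injection (T : Type) (D : set T) (phi : T -> nat) n :
  {in D &, injective phi} -> finite_set [set b | D b /\ (phi b <= n)%N].
Proof.
move=> phiinj; rewrite -(eq_finite_set (@inj_card_eq _ _ _ phi _)).
  apply: sub_finite_set (finite_II n.+1).
  by move=> _ [b [_ bn] <-].
by move=> b c; rewrite !inE => -[Db _] [Dc _]; apply: phiinj; rewrite inE.
Qed.

(** * The space of tower sets and finite sets, and its covers *)

Section tower_space.
Variables (R : realType) (d : Order.disp_t) (W : orderType d).
Hypothesis HW : is_omega1 W.
Variable x : W -> nat -> bool.
Hypothesis x_dec : forall b a, b < a -> almost_sub (x a) (x b).
Hypothesis x_misses : forall m : nat -> nat, (forall k, (m k < m k.+1)%N) ->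
  exists a, infinitely (fun k => misses (x a) (m k) (m k.+1)).

Definition bounded_support (y : nat -> bool) : Prop :=
  exists N, forall n, (N <= n)%N -> ~~ y n.

Definition tower_points : set (nat -> bool) :=
  [set y | bounded_support y \/ exists a, y = x a].

Let X := cantor_subspace R tower_points.

Lemma tower_pt_subproof a : `[< tower_points (x a) >].
Proof. by apply/asboolP; right; exists a. Qed.

Definition tower_pt (a : W) : X := exist _ (x a) (tower_pt_subproof a).

Lemma seq_pt_subproof (s : seq nat) : `[< tower_points (mem s) >].
Proof.
apply/asboolP; left; exists (\max_(n <- s) n).+1 => n; apply: contraL.
by move=> ns; rewrite -leqNgt; exact: leq_bigmax_seq.
Qed.

Definition seq_pt (s : seq nat) : X :=
  exist _ (mem s : nat -> bool) (seq_pt_subproof s).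

Lemma seq_pt_agree (y : nat -> bool) N :
  exists s, (forall i, (i < N)%N -> sval (seq_pt s) i = y i) /\
    forall i, (N <= i)%N -> sval (seq_pt s) i = false.
Proof.
exists [seq i <- iota 0 N | y i]; split=> i iN /=.
  by rewrite [LHS]mem_filter mem_iota add0n iN !andbT.
by rewrite [LHS]mem_filter mem_iota add0n ltnNge iN !andbF.
Qed.

Lemma tower_space_separable : separable_space X.
Proof.
exists (range seq_pt).
  exact: sub_countable (card_image_le _ _) (countableP _).
move=> A [y Ay] oA; have [N yN] := cantor_subspace_open oA Ay.
have [s [sN _]] := seq_pt_agree (sval y) N.
by exists (seq_pt s); split; [exact: yN|exists s].
Qed.

Section cover.
Variable U : set (set X).
Hypothesis U_omega : omega_cover U.

(** Below [M], a point missing [[m, M[] agrees with its trace on [[0, m[]. There are finitely many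
    traces, so one member of [U] contains them all along with [K]; as it is open, a large [M] works
    for every trace. *)
Lemma omega_cover_block m (K : set X) : finite_set K ->
  exists AM : set X * nat, [/\ U AM.1, (m < AM.2)%N, K `<=` AM.1 &
    forall y, misses (sval y) m AM.2 -> AM.1 y].
Proof.
move=> finK; have [[Uopen _] _ Ufin] := U_omega.
pose low (s : {ffun 'I_m -> bool}) : nat -> bool :=
  fun i => if insub i is Some j then s j else false.
have /choice[t tP] : forall s : {ffun 'I_m -> bool}, exists t,
    (forall i, (i < m)%N -> sval (seq_pt t) i = low s i) /\
    forall i, (m <= i)%N -> sval (seq_pt t) i = false.
  by move=> s; exact: seq_pt_agree.
have [|A UA KA] := Ufin (K `|` range (seq_pt \o t)).
  by rewrite finite_setU; split=> //; apply: finite_image; exact: finite_finset.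
have /choice[N NP] : forall s, exists N, forall y : X,
    (forall i, (i < N)%N -> sval y i = sval (seq_pt (t s)) i) -> A y.
  move=> s; apply: cantor_subspace_open; first exact: Uopen.
  by apply: KA; right; exists s.
exists (A, (m + \max_s N s).+1); split=> //=.
- by rewrite ltnS leq_addr.
- by move=> y Ky; apply: KA; left.
move=> y ymiss; pose s := [ffun j : 'I_m => sval y j].
have [t1 t2] := tP s; apply: (NP s) => i iN.
have [im|mi] := ltnP i m.
  by rewrite t1// /low (insubT (fun i => i < m)%N im) ffunE.
rewrite t2//; apply/negbTE; apply: ymiss; rewrite mi ltnS.
apply: leq_trans (leq_addl _ _); apply: leq_trans (ltnW iN) _.
exact: leq_bigmax.
Qed.

(** Blocks are chained end to end from [0]. Stage [k] also covers the finitely many tower points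
    below [a] with [phi] at most [k], so [b] is covered from stage [phi b] on. *)
Lemma omega_cover_blocks (a : W) :
  exists (A : nat -> set X) (m : nat -> nat), [/\ forall k, U (A k),
    forall k, (m k < m k.+1)%N,
    forall k y, misses (sval y) (m k) (m k.+1) -> A k y &
    forall b, b < a -> exists N, forall k, (N <= k)%N -> A k (tower_pt b)].
Proof.
have /countable_injP[phi phiinj] : countable [set b | b < a] by case: HW.
pose K k : set W := [set b | b < a /\ (phi b <= k)%N].
have Kfin k : finite_set (K k).
  exact: finite_bounded_by_injection.
have /choice[st stP] : forall km : nat * nat, exists AM : set X * nat,
    [/\ U AM.1, (km.2 < AM.2)%N, tower_pt @` K km.1 `<=` AM.1 &
    forall y, misses (sval y) km.2 AM.2 -> AM.1 y].
  by move=> [k m]; apply: omega_cover_block; exact: finite_image.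
pose m := fix m k := if k is k.+1 then (st (k, m k)).2 else 0%N.
exists (fun k => (st (k, m k)).1), m; split.
- by move=> k; case: (stP (k, m k)).
- by move=> k; case: (stP (k, m k)).
- by move=> k; case: (stP (k, m k)).
- move=> b ba; exists (phi b) => k bk; case: (stP (k, m k)) => _ _ + _.
  by apply; exists b.
Qed.

Lemma tower_space_gamma_subcover : exists2 V, V `<=` U & gamma_cover V.
Proof.
have [[Uopen _] UT _] := U_omega.
have /choice[A /choice[m AmP]] := omega_cover_blocks.
(* [x b] is almost contained in [x c], so it misses every late enough block that [x c] misses. *)
have catch a : exists c, forall b, c <= b ->
    infinitely (fun k => misses (x b) (m a k) (m a k.+1)).
  have [_ mS _ _] := AmP a; have [c cmiss] := x_misses mS.
  exists c => b; rewrite le_eqVlt => /predU1P[<- //|cb] N.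
  have [M bc] := x_dec cb; have [k Mk kmiss] := cmiss (maxn N M).
  move: Mk; rewrite geq_max => /andP[Nk Mk]; exists k => // i /[dup] ik.
  move=> /andP[mi _]; apply: contra (kmiss i ik); apply: bc.
  by apply: leq_trans mi; apply: leq_trans Mk _; exact: leq_strict_mono.
have /choice[c cP] := catch.
have [a0 _] : [set: W] !=set0.
  by apply: infinite_setN0; case: HW => _ nc _ /finite_set_countable.
(* The maximum keeps [s] monotone and gives [c (s n) <= s n.+1]; hence the set at the supremum
   misses infinitely many blocks attached to each [s n]. *)
pose s n := iter n (fun a => Order.max a (c a)) a0.
have s_le : {homo s : n k / (n <= k)%N >-> n <= k}.
  by apply: homo_leq => // [|n]; [exact: le_trans|rewrite /= le_max lexx].
have [a sa a_lub] := omega1_sup HW s.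
have /countable_injP[phi phiinj] : countable [set b | b < a] by case: HW.
have /choice[k kP] : forall n, exists k, [/\ (n <= k)%N,
    misses (x a) (m (s n) k) (m (s n) k.+1) &
    forall b, b < s n -> (phi b <= n)%N -> A (s n) k (tower_pt b)].
  move=> n; have [_ _ _ Aev] := AmP (s n).
  have [|N NP] := @eventually_finite _ [set b | b < s n /\ (phi b <= n)%N]
      (fun b k => A (s n) k (tower_pt b)) _ (fun b bs => Aev b bs.1).
    apply: sub_finite_set (finite_bounded_by_injection n phiinj) => b [bs bn].
    by split=> //; exact: lt_le_trans bs (sa n).
  have [|k Nk kmiss] := cP (s n) a _ (maxn N n).
    by apply: le_trans (sa n.+1); rewrite /= le_max lexx orbT.
  move: Nk; rewrite geq_max => /andP[Nk nk]; exists k; split=> // b bs bn.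
  exact: NP.
pose V n := A (s n) (k n).
have VU n : U (V n) by have [+ _ _ _] := AmP (s n); exact.
(* The [n]-th chosen block starts at or beyond [n], so a point contained in [x a] from [N] on misses
   the blocks chosen from stage [N] on. *)
have Vmiss (y : X) N : (forall n, (N <= n)%N -> sval y n -> x a n) ->
    forall n, (N <= n)%N -> V n y.
  move=> yN n Nn; have [_ mS Am _] := AmP (s n); have [nk kmiss _] := kP n.
  apply: Am => i /[dup] ik /andP[mi _].
  apply: contra (kmiss i ik); apply: yN.
  apply: leq_trans mi; apply: leq_trans (leq_strict_mono _ mS).
  exact: leq_trans nk.
have Vev (y : X) : exists N, forall n, (N <= n)%N -> V n y.
  case: (y) => y0 /[dup] /asboolP [[N yN]|[b ->]] Py.
    exists N; apply: Vmiss => n /yN /= /negPf -> //.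
  rewrite (_ : exist _ _ _ = tower_pt b); last exact: val_inj.
  (* For [b < a] the inclusion in [x a] may fail; the point is caught instead at the stages with
     [b < s n] and [phi b <= n]. *)
  have [ba|] := ltP b a.
    have [n bn] := a_lub b ba; exists (maxn n (phi b)) => l.
    rewrite geq_max => /andP[nl bl]; have [_ _ +] := kP l; apply=> //.
    exact: lt_le_trans bn (s_le _ _ nl).
  rewrite le_eqVlt => /predU1P[<-|/x_dec[N bN]]; last by exists N; exact: Vmiss.
  by exists 0%N; exact: Vmiss.
exists (range V); first by move=> _ [n _ <-].
split.
- split; first by move=> _ [n _ <-]; exact: Uopen.
  rewrite eqEsubset; split=> // y _; have [N /(_ N (leqnn N)) VN] := Vev y.
  by exists (V N) => //; exists N.
(* Each member omits a point that lies in all late [V n]. Were there finitely many members, some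
   [V N] would differ from all of them, itself included. *)
- move=> /eventually_finite-/(_ (fun B n => exists2 y, ~ B y & V n y))[].
    move=> _ [n _ <-]; have [y nVy] : exists y, ~ V n y.
      apply: contrapT => allV; apply: UT; rewrite -(_ : V n = setT)//.
      rewrite eqEsubset; split=> // y _; apply: contrapT => nVy.
      by apply: allV; exists y.
    by have [N yN] := Vev y; exists N => l Nl; exists y => //; exact: yN.
  by move=> N /(_ N (leqnn N) (V N) (ex_intro2 _ _ N I erefl))[y].
- move=> y; have [N yN] := Vev y.
  apply: (@sub_finite_set _ _ (V @` `I_N)); last exact: finite_image.
  move=> _ [[n _ <-] nV]; exists n => //=; rewrite ltnNge; apply/negP.
  by move=> /yN.
Qed.

End cover.

Lemma tower_space_gamma : gamma_set X.
Proof.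
by split; [exact: tower_space_separable|exact: tower_space_gamma_subcover].
Qed.

Lemma tower_space_uncountable : injective x -> ~ countable [set: X].
Proof.
move=> xinj /countable_injP[phi phiinj]; case: HW => _ + _; apply.
apply/countable_injP; exists (phi \o tower_pt) => a b _ _ /= /phiinj e.
by apply: xinj; have := congr1 sval (e (in_setT _) (in_setT _)).
Qed.

End tower_space.

Theorem theorem11 (R : realType) (d : Order.disp_t) (W : orderType d)
    (HW : is_omega1 W) :
  diamond_b W ->
  exists X : metricType R, gamma_set X /\ ~ countable [set: X].
Proof.
move=> /(diamond_b_unbounded HW)[g g_unb].
have [x [x_dec x_inj x_sparse]] := sparse_tower HW g.
exists (cantor_subspace R (tower_points x)); split.
  apply: (tower_space_gamma R HW x_dec) => m mS.
  (* The shift by two fits two consecutive blocks, from [m n] to [m n.+2], into [[n, g a n[] for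
     infinitely many [n]. *)
  have [a ga] := g_unb (fun n => m n.+2).
  by exists a; exact: sparse_misses (x_sparse a) mS ga.
exact: tower_space_uncountable.
Qed.
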